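(* Let $d\ge1$ and $n\ge3$ be integers. Let ${\rm tr}$ be the Markov trace on $\bigcup_{m\ge1}{\rm Y}_{d,m}(u)$ with parameters $z\in K=\mathbb{C}(u)$ and $x_1,\dots,x_{d-1}\in\mathbb{C}$. If the parameters $x_i$ are $d$-th roots of unity with $x_i=x_1^i$ for $1\le i\le d-1$, and $z=-\frac{1}{u+1}$ or $z=-1$, then ${\rm tr}$ passes to the quotient ${\rm YTL}_{d,n}(u)$.
   Context: Let $u$ be an indeterminate and $K=\mathbb{C}(u)$; algebras are associative unital $K$-algebras. The Yokonuma--Hecke algebra ${\rm Y}_{d,n}(u)$ is the $K$-algebra generated by $g_1,\dots,g_{n-1},t_1,\dots,t_n$ subject to: $g_ig_j=g_jg_i$ for $|i-j|>1$; $g_{i+1}g_ig_{i+1}=g_ig_{i+1}g_i$; $g_i^2=1+(u-1)e_i+(u-1)e_ig_i$; $t_it_j=t_jt_i$ for all $i,j$; $t_i^d=1$; $g_it_i=t_{i+1}g_i$; $g_it_{i+1}=t_ig_i$; $g_it_j=t_jg_i$ for $j\ne i,i+1$; where $e_i:=\frac1d\sum_{s=0}^{d-1}t_i^st_{i+1}^{-s}$. One regards ${\rm Y}_{d,n}(u)\subset{\rm Y}_{d,n+1}(u)$ in the natural way. For $|i-j|=1$ put $g_{i,j}:=1+g_i+g_j+g_ig_j+g_jg_i+g_ig_jg_i$. For $n\ge3$, the Yokonuma--Temperley--Lieb algebra is ${\rm YTL}_{d,n}(u):={\rm Y}_{d,n}(u)/I$, where $I$ is the two-sided ideal generated by all $g_{i,j}$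 with $|i-j|=1$. Markov trace (a known theorem of Juyumaya): for given parameters $z,x_1,\dots,x_{d-1}$ there is a unique linear map ${\rm tr}$ on $\bigcup_{m\ge1}{\rm Y}_{d,m}(u)$ such that, for all $m$ and all $a,b\in{\rm Y}_{d,m}(u)$: ${\rm tr}(ab)={\rm tr}(ba)$; ${\rm tr}(1)=1$; ${\rm tr}(ag_m)=z\,{\rm tr}(a)$; ${\rm tr}(at_{m+1}^s)=x_s{\rm tr}(a)$ for $s=1,\dots,d-1$. ''${\rm tr}$ passes to the quotient ${\rm YTL}_{d,n}(u)$'' means that ${\rm tr}$ restricted to ${\rm Y}_{d,n}(u)$ vanishes on $I$. *)

(* Defs.v *)
From HB Require Import structures.
From mathcomp Require Import all_boot all_order all_algebra.
From mathcomp Require Import generic_quotient ring_quotient.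
From mathcomp Require Import boolp.
From mathcomp Require Import reals.
From mathcomp Require Import complex.
From mathcomp Require Import monalg.

Set Implicit Arguments.
Unset Strict Implicit.
Unset Printing Implicit Defensive.

Import GRing.Theory.
Local Open Scope ring_scope.
Local Open Scope quotient_scope.

Section TwoSidedIdeal.
Variable A : nzRingType.

Definition two_sided_ideal (I : A -> Prop) : Prop :=
  [/\ I 0,
      forall a b, I a -> I b -> I (a + b),
      forall a b, I b -> I (a * b) &
      forall a b, I a -> I (a * b)].

Definition ideal_gen (S : A -> Prop) (a : A) : Prop :=
  forall I : A -> Prop,
    two_sided_ideal I -> (forall s, S s -> I s) -> I a.

Variable S : A -> Prop.

Lemma ideal_gen_ideal : two_sided_ideal (ideal_gen S).
Proof.
split=> [I [] // | a b Sa Sb I II IS | a b Sb I II IS | a b Sa I II IS].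
- by case: (II) => _ + _ _; apply; [apply: Sa | apply: Sb].
- by case: (II) => _ _ + _; apply; apply: Sb.
- by case: (II) => _ _ _; apply; apply: Sa.
Qed.

Lemma ideal_gen_incl s : S s -> ideal_gen S s.
Proof. by move=> Ss I _; apply. Qed.

Definition ideal_pred : {pred A} := fun a => `[< ideal_gen S a >].

Lemma ideal_predP a : reflect (ideal_gen S a) (a \in ideal_pred).
Proof. exact: asboolP. Qed.

Fact ideal_pred_zmod_closed : zmod_closed ideal_pred.
Proof.
have [I0 ID IMl IMr] := ideal_gen_ideal.
split=> [|a b /ideal_predP Ia /ideal_predP Ib]; apply/ideal_predP => //.
by apply: (ID) => //; rewrite -mulN1r; apply: IMl.
Qed.

HB.instance Definition _ :=
  GRing.isZmodClosed.Build A ideal_pred ideal_pred_zmod_closed.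

End TwoSidedIdeal.

(* The quotient ring is possibly trivial, hence only a pzRingType. *)
Definition quot_ring (A : nzRingType) (S : A -> Prop) : Type :=
  Quotient.quot (ideal_pred S).

Section QuotRing.
Variables (A : nzRingType) (S : A -> Prop).
Local Notation Q := (quot_ring S).

HB.instance Definition _ := GRing.Zmodule.on Q.
HB.instance Definition _ := EqQuotient.on Q.

Definition quot_proj (a : A) : Q := \pi_Q a.
Definition quot_repr (x : Q) : A := repr x.

Lemma quot_reprK x : quot_proj (quot_repr x) = x.
Proof. exact: reprK. Qed.

Lemma quot_projP a b : quot_proj a = quot_proj b <-> ideal_gen S (a - b).
Proof.
split=> [/eqP|/ideal_predP]; rewrite ?Quotient.idealrBE; last by move/eqP.
by rewrite -Quotient.idealrBE => /ideal_predP.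
Qed.

Fact quot_proj_zmod : zmod_morphism quot_proj.
Proof.
move=> a b; rewrite /quot_proj.
exact: (@raddfB _ _ (\pi_(Quotient.quot (ideal_pred S)))).
Qed.
HB.instance Definition _ := GRing.isZmodMorphism.Build A Q quot_proj quot_proj_zmod.

Definition quot_one : Q := quot_proj 1.
Definition quot_mul (x y : Q) : Q := quot_proj (quot_repr x * quot_repr y).

Lemma quot_repr_proj a : ideal_gen S (quot_repr (quot_proj a) - a).
Proof. by apply/quot_projP; rewrite quot_reprK. Qed.

Lemma quot_mulE a b : quot_mul (quot_proj a) (quot_proj b) = quot_proj (a * b).
Proof.
have [I0 ID IMl IMr] := ideal_gen_ideal S.
apply/quot_projP.
set a' := quot_repr _; set b' := quot_repr _.
have -> : a' * b' - a * b = a' * (b' - b) + (a' - a) * b.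
  by rewrite mulrBr mulrBl addrA subrK.
by apply: ID; [apply: IMl | apply: IMr]; apply: quot_repr_proj.
Qed.

Fact quot_mulA : associative quot_mul.
Proof.
move=> x y z; rewrite -[x]quot_reprK -[y]quot_reprK -[z]quot_reprK.
by rewrite !quot_mulE mulrA.
Qed.

Fact quot_mul1 : left_id quot_one quot_mul.
Proof. by move=> x; rewrite -[x]quot_reprK quot_mulE mul1r. Qed.

Fact quot_mulr1 : right_id quot_one quot_mul.
Proof. by move=> x; rewrite -[x]quot_reprK quot_mulE mulr1. Qed.

Fact quot_mulDl : left_distributive quot_mul +%R.
Proof.
move=> x y z; rewrite -[x]quot_reprK -[y]quot_reprK -[z]quot_reprK.
by rewrite -raddfD !quot_mulE -raddfD mulrDl.
Qed.

Fact quot_mulDr : right_distributive quot_mul +%R.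
Proof.
move=> x y z; rewrite -[x]quot_reprK -[y]quot_reprK -[z]quot_reprK.
by rewrite -raddfD !quot_mulE -raddfD mulrDr.
Qed.

HB.instance Definition _ := GRing.Zmodule_isPzRing.Build Q
  quot_mulA quot_mul1 quot_mulr1 quot_mulDl quot_mulDr.

Fact quot_proj_monoid : monoid_morphism quot_proj.
Proof. by split=> // a b; rewrite [RHS]quot_mulE. Qed.
HB.instance Definition _ :=
  GRing.isMonoidMorphism.Build A Q quot_proj quot_proj_monoid.

End QuotRing.

Section QuotAlg.
Variables (K : comNzRingType) (A : algType K) (S : A -> Prop).
Local Notation Q := (quot_ring S).

Definition quot_scale (c : K) (x : Q) : Q := quot_proj S c%:A * x.

Fact quot_scaleA a b x : quot_scale a (quot_scale b x) = quot_scale (a * b) x.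
Proof. by rewrite /quot_scale mulrA -rmorphM /= mulr_algl scalerA. Qed.

Fact quot_scale1 : left_id 1 quot_scale.
Proof. by move=> x; rewrite /quot_scale scale1r rmorph1 mul1r. Qed.

Fact quot_scaleDr : right_distributive quot_scale +%R.
Proof. by move=> c x y; rewrite /quot_scale mulrDr. Qed.

Fact quot_scaleDl x : {morph quot_scale^~ x : a b / a + b}.
Proof. by move=> a b; rewrite /quot_scale scalerDl raddfD mulrDl. Qed.

HB.instance Definition _ := GRing.Zmodule_isLmodule.Build K Q
  quot_scaleA quot_scale1 quot_scaleDr quot_scaleDl.

Fact quot_proj_scalable : scalable (@quot_proj A S).
Proof. by move=> c a; rewrite -[c *: a]mulr_algl rmorphM. Qed.
HB.instance Definition _ :=
  GRing.isScalable.Build K A Q *:%R (@quot_proj A S) quot_proj_scalable.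

Lemma quot_scalerAl c (x y : Q) : c *: (x * y) = c *: x * y.
Proof. exact: mulrA. Qed.

Lemma quot_scalerAr c (x y : Q) : c *: (x * y) = x * (c *: y).
Proof.
rewrite -[x]quot_reprK -[y]quot_reprK -[c *: quot_proj _ _ in RHS]linearZ.
by rewrite -!rmorphM -linearZ /= scalerAr.
Qed.

End QuotAlg.

(* The free unital associative algebra on X: the monoid algebra of words. *)
Definition free_alg (K : comNzRingType) (X : choiceType) : Type :=
  {malg K[{fmonom X}]}.

Section FreeAlg.
Variables (K : comNzRingType) (X : choiceType).
Local Notation F := (free_alg K X).

HB.instance Definition _ := GRing.Lalgebra.on F.

Fact free_scalerAr c (x y : F) : c *: (x * y) = x * (c *: y).
Proof.
suff cP (z : F) : c%:MP * z = z * c%:MP :> F.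
  by rewrite -!mul_malgC mulrA cP [RHS]mulrA.
rewrite [z]monalgE mulr_sumr mulr_suml; apply: eq_bigr => m _.
by rewrite !malgM_def !fgmulUU mul1m mulm1 mulrC.
Qed.
HB.instance Definition _ := GRing.Lalgebra_isAlgebra.Build K F free_scalerAr.


Definition free_gen (x : X) : F := << fmu x >>.

Variables (B : algType K) (y : X -> B).

Definition word_eval (m : {fmonom X}) : B := \prod_(x <- (m : seq X)) y x.

Fact word_eval_mmorphism : mmorphism word_eval.
Proof.
split=> [m1 m2|]; first by rewrite /word_eval fmM big_cat.
by rewrite /word_eval fm1 big_nil.
Qed.
HB.instance Definition _ :=
  isMultiplicative.Build {fmonom X} B word_eval word_eval_mmorphism.

Definition free_eval : F -> B := mmap (in_alg B) word_eval.

Fact free_eval_zmod : zmod_morphism free_eval.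
Proof. by move=> a b; rewrite /free_eval raddfB. Qed.
HB.instance Definition _ := GRing.isZmodMorphism.Build F B free_eval free_eval_zmod.

Fact free_eval_monoid : monoid_morphism free_eval.
Proof.
suff [] : multiplicative free_eval by split.
apply: commr_mmap_is_multiplicative => a m m'.
by rewrite /GRing.comm /= mulr_algl mulr_algr.
Qed.
HB.instance Definition _ :=
  GRing.isMonoidMorphism.Build F B free_eval free_eval_monoid.

Fact free_eval_scalable : scalable free_eval.
Proof.
by move=> c a; rewrite /free_eval [LHS]mmapZ /= mulr_algl.
Qed.
HB.instance Definition _ :=
  GRing.isScalable.Build K F B *:%R free_eval free_eval_scalable.

Lemma free_eval_gen x : free_eval (free_gen x) = y x.
Proof.
by rewrite /free_eval mmapU /word_eval fmU big_seq1 /= scale1r mul1r.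
Qed.

End FreeAlg.

Section QuotLift.
Variables (A : nzRingType) (S : A -> Prop) (B : nzRingType).

Definition quot_lift (f : A -> B) (x : quot_ring S) : B := f (quot_repr x).

Variable f : {rmorphism A -> B}.
Hypothesis fS : forall a, S a -> f a = 0.

Lemma ideal_gen_ker a : ideal_gen S a -> f a = 0.
Proof.
move=> Ia; apply: (Ia (fun a => f a = 0)); last exact: fS.
split=> [|b c fb fc|b c fc|b c fb]; first exact: rmorph0.
- by rewrite rmorphD fb fc addr0.
- by rewrite rmorphM fc mulr0.
- by rewrite rmorphM fb mul0r.
Qed.

Lemma quot_liftE a : quot_lift f (quot_proj S a) = f a.
Proof.
apply/eqP; rewrite -subr_eq0 -rmorphB; apply/eqP/ideal_gen_ker.
exact: quot_repr_proj.
Qed.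

End QuotLift.

Section Relations.
Variables (K : fieldType) (u : K) (d n : nat) (A : algType K).
Variables (g : 'I_n.-1 -> A) (t : 'I_n -> A).

(* As [b ^+ d = 1] is one of the relations, [b ^+ (d - s)] stands for the     *)
(* negative power [b ^- s].                                                   *)
Definition yh_e (a b : A) : A :=
  d%:R^-1 *: \sum_(s < d) a ^+ s * b ^+ (d - s).

(* Indices start at 0: [g i] and [t i] are the generators usually written     *)
(* g_{i+1} and t_{i+1}. Below, [j] and [k] are the indices [i] and [i + 1]    *)
(* seen in ['I_n].                                                            *)
Inductive yh_rel : A -> A -> Prop :=
| YhFar (i j : 'I_n.-1) of (i.+1 < j)%N || (j.+1 < i)%N :
    yh_rel (g i * g j) (g j * g i)
| YhBraid (i i' : 'I_n.-1) of i' = i.+1 :> nat :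
    yh_rel (g i' * g i * g i') (g i * g i' * g i)
| YhQuad (i : 'I_n.-1) (j k : 'I_n) of j = i :> nat & k = i.+1 :> nat :
    yh_rel (g i ^+ 2)
      (1 + (u - 1) *: yh_e (t j) (t k) + (u - 1) *: (yh_e (t j) (t k) * g i))
| YhTT (j k : 'I_n) :
    yh_rel (t j * t k) (t k * t j)
| YhTd (j : 'I_n) :
    yh_rel (t j ^+ d) 1
| YhGTl (i : 'I_n.-1) (j k : 'I_n) of j = i :> nat & k = i.+1 :> nat :
    yh_rel (g i * t j) (t k * g i)
| YhGTr (i : 'I_n.-1) (j k : 'I_n) of j = i :> nat & k = i.+1 :> nat :
    yh_rel (g i * t k) (t j * g i)
| YhGT (i : 'I_n.-1) (l : 'I_n) of l != i :> nat & l != i.+1 :> nat :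
    yh_rel (g i * t l) (t l * g i).

Definition yh_sat : Prop := forall a b, yh_rel a b -> a = b.

End Relations.

Arguments yh_rel {K} u d {n A} g t.
Arguments yh_sat {K} u d {n A} g t.

Definition yh_free (K : fieldType) (n : nat) := free_alg K ('I_n.-1 + 'I_n)%type.

Definition yh_relator (K : fieldType) (u : K) (d n : nat) (a : yh_free K n)
    : Prop :=
  exists b c : yh_free K n,
    yh_rel u d (fun i => free_gen K (inl i)) (fun j => free_gen K (inr j)) b c
    /\ a = b - c.

Definition yokonuma_hecke (K : fieldType) (u : K) (d n : nat) : Type :=
  quot_ring (@yh_relator K u d n).

Section YHTheory.
Variables (K : fieldType) (u : K) (d : nat).
Local Notation Y := (yokonuma_hecke u d).

HB.instance Definition _ n := GRing.PzRing.on (Y n).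
HB.instance Definition _ n := GRing.Lmodule.on (Y n).

Definition yh_proj n : yh_free K n -> Y n := @quot_proj _ _.
HB.instance Definition _ n := GRing.RMorphism.on (@yh_proj n).
HB.instance Definition _ n := GRing.Linear.on (@yh_proj n).

Definition yh_g n (i : 'I_n.-1) : Y n := yh_proj (free_gen K (inl i)).
Definition yh_t n (j : 'I_n) : Y n := yh_proj (free_gen K (inr j)).

Definition yh_lift n (B : algType K) (g : 'I_n.-1 -> B) (t : 'I_n -> B)
    : Y n -> B :=
  quot_lift (free_eval (fun x => match x with inl i => g i | inr j => t j end)).

Section RelMorph.
Variables (n : nat) (A B : algType K) (f : {lrmorphism A -> B}).
Variables (g : 'I_n.-1 -> A) (t : 'I_n -> A).
Variables (g' : 'I_n.-1 -> B) (t' : 'I_n -> B).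
Hypotheses (fg : forall i, f (g i) = g' i) (ft : forall j, f (t j) = t' j).

Lemma yh_e_morph j k : f (yh_e d (t j) (t k)) = yh_e d (t' j) (t' k).
Proof.
rewrite /yh_e linearZ rmorph_sum; congr (_ *: _); apply: eq_bigr => s _.
by rewrite rmorphM !rmorphXn /= !ft.
Qed.

Let fD a b : f (a + b) = f a + f b. Proof. exact: rmorphD. Qed.
Let fM a b : f (a * b) = f a * f b. Proof. exact: rmorphM. Qed.
Let fX a k : f (a ^+ k) = f a ^+ k. Proof. exact: rmorphXn. Qed.
Let f1 : f 1 = 1. Proof. exact: rmorph1. Qed.
Let fZ c a : f (c *: a) = c *: f a. Proof. exact: linearZ. Qed.
Let fE := (yh_e_morph, fg, ft, f1, fD, fX, fM, fZ).

Lemma yh_rel_morph a b : yh_rel u d g t a b -> yh_rel u d g' t' (f a) (f b).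
Proof.
case=> [i j ij|i i' ii'|i j k ij ik|j k|j|i j k ij ik|i j k ij ik|i l li lk];
  rewrite ?fE.
- exact: YhFar.
- exact: YhBraid.
- exact: YhQuad.
- exact: YhTT.
- exact: YhTd.
- exact: YhGTl.
- exact: YhGTr.
- exact: YhGT.
Qed.

Lemma yh_sat_morph :
  (forall a b, yh_rel u d g t a b -> f a = f b) -> yh_sat u d g' t'.
Proof.
move=> H _ _
  [i j ij|i i' ii'|i j k ij ik|j k|j|i j k ij ik|i j k ij ik|i l li lk].
- by have := H _ _ (YhFar u d g t ij); rewrite ?fE.
- by have := H _ _ (YhBraid u d g t ii'); rewrite ?fE.
- by have := H _ _ (YhQuad u d g t ij ik); rewrite ?fE.
- by have := H _ _ (YhTT u d g t j k); rewrite ?fE.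
- by have := H _ _ (YhTd u d g t j); rewrite ?fE.
- by have := H _ _ (YhGTl u d g t ij ik); rewrite ?fE.
- by have := H _ _ (YhGTr u d g t ij ik); rewrite ?fE.
- by have := H _ _ (YhGT u d g t li lk); rewrite ?fE.
Qed.

End RelMorph.

Section Lift.
Variables (n : nat) (B : algType K) (g : 'I_n.-1 -> B) (t : 'I_n -> B).
Hypothesis sat : yh_sat u d g t.

Lemma yh_liftE a :
  yh_lift g t (yh_proj a) =
  free_eval (fun x => match x with inl i => g i | inr j => t j end) a.
Proof.
apply: quot_liftE => _ [b [c [bc ->]]]; rewrite rmorphB; apply/eqP.
rewrite subr_eq0; apply/eqP/sat.
by apply: yh_rel_morph bc => i; apply: free_eval_gen.
Qed.

Lemma yh_lift_g i : yh_lift g t (yh_g i) = g i.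
Proof. by rewrite yh_liftE free_eval_gen. Qed.

Lemma yh_lift_t j : yh_lift g t (yh_t j) = t j.
Proof. by rewrite yh_liftE free_eval_gen. Qed.

End Lift.

Fact yh_oner_neq0 n : (1 : Y n) != 0.
Proof.
pose g (i : 'I_n.-1) : K^o := -1; pose t (j : 'I_n) : K^o := 1.
have sat : yh_sat u d g t.
  move=> a b []; rewrite /g /t => *; rewrite ?(mulr1, mul1r, expr1n) //.
  by rewrite sqrrN expr1n mulrN1 scalerN addrK.
apply/eqP => /(congr1 (yh_lift g t)).
rewrite -[1](rmorph1 (@yh_proj n)) -[0](rmorph0 (@yh_proj n)) !yh_liftE //.
by rewrite rmorph1 rmorph0 => /eqP; rewrite oner_eq0.
Qed.

HB.instance Definition _ n :=
  GRing.PzSemiRing_isNonZero.Build (Y n) (@yh_oner_neq0 n).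
HB.instance Definition _ n :=
  GRing.Lmodule_isLalgebra.Build K (Y n) (@quot_scalerAl _ _ _).
HB.instance Definition _ n :=
  GRing.Lalgebra_isAlgebra.Build K (Y n) (@quot_scalerAr _ _ _).

Lemma yh_projK n (x : Y n) : exists a, x = yh_proj a.
Proof. by exists (quot_repr x); rewrite /yh_proj quot_reprK. Qed.

Lemma yh_gen_sat n : yh_sat u d (@yh_g n) (@yh_t n).
Proof.
apply: (@yh_sat_morph _ _ _ (@yh_proj n) (fun i => free_gen K (inl i))
          (fun j => free_gen K (inr j))) => // a b ab.
apply: (proj2 (quot_projP _ _ _)); apply: ideal_gen_incl.
by exists a, b.
Qed.

Section LiftMorphism.
Variables (n : nat) (B : algType K) (g : 'I_n.-1 -> B) (t : 'I_n -> B).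
Hypothesis sat : yh_sat u d g t.

Lemma yh_lift_zmod : zmod_morphism (yh_lift g t : Y n -> B).
Proof.
move=> x y; have [a ->] := yh_projK x; have [b ->] := yh_projK y.
by rewrite -rmorphB !yh_liftE // rmorphB.
Qed.

Lemma yh_lift_monoid : monoid_morphism (yh_lift g t : Y n -> B).
Proof.
split=> [|x y]; first by rewrite -(rmorph1 (@yh_proj n)) yh_liftE // rmorph1.
have [a ->] := yh_projK x; have [b ->] := yh_projK y.
by rewrite -rmorphM !yh_liftE // rmorphM.
Qed.

Lemma yh_lift_scalable : scalable (yh_lift g t : Y n -> B).
Proof.
move=> c x; have [a ->] := yh_projK x.
by rewrite -linearZ !yh_liftE // linearZ.
Qed.

End LiftMorphism.

(* The natural map Y_{d,n}(u) -> Y_{d,n+1}(u). *)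
Definition yh_incl n : Y n -> Y n.+1 :=
  yh_lift (fun i => @yh_g n.+1 (widen_ord (leq_pred n) i))
          (fun j => @yh_t n.+1 (widen_ord (leqnSn n) j)).

Fact yh_incl_sat n :
  yh_sat u d (fun i => @yh_g n.+1 (widen_ord (leq_pred n) i))
             (fun j => @yh_t n.+1 (widen_ord (leqnSn n) j)).
Proof.
move=> a b ab; apply: yh_gen_sat.
case: ab => [i j ij|i i' ii'|i j k ij ik|j k|j|i j k ij ik|i j k ij ik|i l li lk].
- exact: YhFar.
- exact: YhBraid.
- exact: YhQuad.
- exact: YhTT.
- exact: YhTd.
- exact: YhGTl.
- exact: YhGTr.
- exact: YhGT.
Qed.

HB.instance Definition _ n := GRing.isZmodMorphism.Build (Y n) (Y n.+1)
  (@yh_incl n) (yh_lift_zmod (@yh_incl_sat n)).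
HB.instance Definition _ n := GRing.isMonoidMorphism.Build (Y n) (Y n.+1)
  (@yh_incl n) (yh_lift_monoid (@yh_incl_sat n)).
HB.instance Definition _ n := GRing.isScalable.Build K (Y n) (Y n.+1) *:%R
  (@yh_incl n) (yh_lift_scalable (@yh_incl_sat n)).

Lemma yh_incl_g n (i : 'I_n.-1) :
  yh_incl (yh_g i) = @yh_g n.+1 (widen_ord (leq_pred n) i).
Proof. exact/yh_lift_g/yh_incl_sat. Qed.

Lemma yh_incl_t n (j : 'I_n) :
  yh_incl (yh_t j) = @yh_t n.+1 (widen_ord (leqnSn n) j).
Proof. exact/yh_lift_t/yh_incl_sat. Qed.

(* A linear map on the union of the tower is given by its restrictions        *)
(* [tr m] to Y_{d,m}(u), compatible with the natural maps; only m >= 1 is     *)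
(* constrained. In Y_{d,m+2}(u), [ord_max] is the last index, so that         *)
(* [yh_g ord_max] and [yh_t ord_max] are the generators written g_{m+1} and   *)
(* t_{m+2}.                                                                   *)
Record is_markov_trace (z : K) (x : nat -> K) (tr : forall m, {scalar Y m})
    : Prop := IsMarkovTrace {
  markov_incl : forall m (a : Y m.+1), tr m.+2 (yh_incl a) = tr m.+1 a;
  markov_mulC : forall m (a b : Y m.+1), tr m.+1 (a * b) = tr m.+1 (b * a);
  markov_1 : forall m, tr m.+1 1 = 1;
  markov_g : forall m (a : Y m.+1),
    tr m.+2 (yh_incl a * @yh_g m.+2 ord_max) = z * tr m.+1 a;
  markov_t : forall m (a : Y m.+1) s, (1 <= s <= d - 1)%N ->
    tr m.+2 (yh_incl a * @yh_t m.+2 ord_max ^+ s) = x s * tr m.+1 a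
}.

Definition yh_gg n (i j : 'I_n.-1) : Y n :=
  1 + yh_g i + yh_g j + yh_g i * yh_g j + yh_g j * yh_g i
  + yh_g i * yh_g j * yh_g i.

Definition ytl_relator n (a : Y n) : Prop :=
  exists i j : 'I_n.-1,
    (j == i.+1 :> nat) || (i == j.+1 :> nat) /\ a = yh_gg i j.

Definition yokonuma_temperley_lieb n : Type := quot_ring (@ytl_relator n).

HB.instance Definition _ n := GRing.PzRing.on (yokonuma_temperley_lieb n).
HB.instance Definition _ n := GRing.Lmodule.on (yokonuma_temperley_lieb n).

(* [f] is constant on the fibres of [quot_proj (@ytl_relator n)]. *)
Definition passes_to_ytl n (f : Y n -> K) : Prop :=
  forall a : Y n, ideal_gen (@ytl_relator n) a -> f a = 0.

End YHTheory.

(* The complex numbers are R[i], for R a model of the real numbers. *)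
Definition Cu (R : realType) : fieldType := {fraction {poly R[i]}}.

Definition indet (R : realType) : Cu R := tofrac 'X.

Definition Cu_const (R : realType) (c : R[i]) : Cu R := tofrac c%:P.

(* Main.v *)
Require Import Defs.
From mathcomp Require Import all_boot all_order all_algebra.
From mathcomp Require Import reals complex.
From mathcomp Require Import monalg.
From mathcomp Require Import ring.

Set Implicit Arguments.
Unset Strict Implicit.
Unset Printing Implicit Defensive.

Import GRing.Theory.
Local Open Scope ring_scope.

(** Let J_m be the radical of the trace form on Y_m, i.e. the set of all c such
    that tr(ac) = 0 for every a. It is a two-sided ideal because tr is a trace,
    so the theorem says that J_n contains the generators
      g_{i,j} = 1 + g_i + g_j + g_i g_j + g_j g_i + g_i g_j g_i
    of I; then tr vanishes on I (take a = 1).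

    The Markov rules make the radicals grow along the tower: Y_{m+1} is spanned
    by the elements a t_{m+1}^s and a g_m b with a, b in Y_m ([last_spanT]), and
    on such elements the rules turn the trace of a product with c into a
    multiple of some tr(a'c) computed in Y_m; hence J_m is contained in J_{m+1}
    ([tr_radical_incl]).

    Put chi = x_1, or chi = 1 if d = 1, so that x_s = chi^s and chi^d = 1. Then
    t_j - chi lies in the radical for all j. For j = 1 this is seen in Y_1; it
    climbs the tower by the inclusion above; and it passes from t_j to t_{j+1}
    by conjugating with g_j, where the correction terms in g_j^2 disappear since
    t_j e_j = t_{j+1} e_j ([tr_mul_t_next]). Therefore e_j acts as 1 modulo the
    radical, and the quadratic relation becomes the Hecke relation
    g_j^2 = u + (u - 1) g_j ([tr_mul_g2]). In other words tr factors through the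
    Iwahori--Hecke algebra.

    There g_{i,j} is an eigenvector, g_i g_{i,j} = u g_{i,j} = g_j g_{i,j}
    ([tr_mul_gg]). In Y_3, generated by g_1, g_2 and the t_j, this makes
    tr(a g_{1,2}) proportional to
      tr(g_{1,2}) = (z + 1) ((u + 1) z + 1),
    which is zero precisely for the two given values of z ([tr_gg01]). So
    g_{1,2} is in J_3, thus in J_n. All g_{i,i+1} are conjugate under products
    of the g_k, which are invertible modulo the radical as u <> 0
    ([tr_radical_cancel]), and g_{i+1,i} = g_{i,i+1} by the braid relation. *)

(** * Generation and relations *)

(** Y_n is spanned by the words in its generators, being a quotient of the free
    algebra. *)
Lemma yh_ind (K : fieldType) (u : K) d n (P : yokonuma_hecke u d n -> Prop) :
    P 1 -> (forall a b, P a -> P b -> P (a + b)) ->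
    (forall c a, P a -> P (c *: a)) ->
    (forall a i, P a -> P (a * yh_g u d i)) ->
    (forall a j, P a -> P (a * yh_t u d j)) ->
  forall a, P a.
Proof.
move=> P1 PD PZ Pg Pt a; have [b ->] := yh_projK a.
have P0 : P 0 by rewrite -(scale0r 1); apply: PZ.
have Pw (s : seq ('I_n.-1 + 'I_n)) :
    P (yh_proj u d (<< FMonom s >> : yh_free K n)).
  elim/last_ind: s => [|s x IHs].
    by rewrite -fmoneE; move: P1; rewrite -(rmorph1 (yh_proj u d (n:=n))).
  have -> : << FMonom (rcons s x) >> =
      (<< FMonom s >> : yh_free K n) * free_gen K x.
    rewrite [RHS]malgM_def fgmulUU mulr1; congr << _ >>.
    by apply/val_inj; rewrite /= fmM fmU cats1.
  by rewrite rmorphM; case: x => [i|j]; [apply: Pg | apply: Pt].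
rewrite [b]monalgE rmorph_sum; elim/big_ind: _ => // -[s] _ /=.
set c := _@__.
have -> : << c *g FMonom s >> = c *: (<< FMonom s >> : yh_free K n).
  by rewrite -mul_malgC [RHS]malgM_def fgmulUU mulr1 mul1m.
by rewrite linearZ; apply: PZ; apply: Pw.
Qed.

Section Relations.
Context {K : fieldType} {u : K} {d n : nat} {A : algType K}.
Context {g : 'I_n.-1 -> A} {t : 'I_n -> A} (sat : yh_sat u d g t).
Implicit Types (i : 'I_n.-1) (j k l : 'I_n).

Local Notation e j k := (yh_e d (t j) (t k)).

Lemma g_far i i' : (i.+1 < i')%N || (i'.+1 < i)%N -> g i * g i' = g i' * g i.
Proof. by move=> ii'; apply: sat; apply: YhFar. Qed.

Lemma g_braid i i' : i' = i.+1 :> nat -> g i' * g i * g i' = g i * g i' * g i.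
Proof. by move=> ii'; apply: sat; apply: YhBraid. Qed.

Lemma g_quad i j k : j = i :> nat -> k = i.+1 :> nat ->
  g i ^+ 2 = 1 + (u - 1) *: e j k + (u - 1) *: (e j k * g i).
Proof. by move=> ij ik; apply: sat; apply: YhQuad. Qed.

Lemma t_comm j k : t j * t k = t k * t j.
Proof. by apply: sat; apply: YhTT. Qed.

Lemma t_order j : t j ^+ d = 1.
Proof. by apply: sat; apply: YhTd. Qed.

Lemma g_tl i j k : j = i :> nat -> k = i.+1 :> nat -> g i * t j = t k * g i.
Proof. by move=> ij ik; apply: sat; apply: YhGTl. Qed.

Lemma g_tr i j k : j = i :> nat -> k = i.+1 :> nat -> g i * t k = t j * g i.
Proof. by move=> ij ik; apply: sat; apply: YhGTr. Qed.

Lemma g_t i l : l != i :> nat -> l != i.+1 :> nat -> g i * t l = t l * g i.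
Proof. by move=> il il'; apply: sat; apply: YhGT. Qed.

Lemma g_tlX i j k s : j = i :> nat -> k = i.+1 :> nat ->
  g i * t j ^+ s = t k ^+ s * g i.
Proof.
move=> ij ik; elim: s => [|s IHs]; first by rewrite !expr0 mulr1 mul1r.
by rewrite !exprSr mulrA IHs -!mulrA (g_tl ij ik).
Qed.

(** Both sides are the same sum over the cyclic group of order d, shifted by
    one step: the idempotent e identifies the two torus generators. *)
Lemma t_e j k : t j * e j k = t k * e j k.
Proof.
rewrite /yh_e -2!scalerAr; congr (_ *: _).
pose f s := t j ^+ s * t k ^+ (d.+1 - s).
have tjE (s : 'I_d) : t j * (t j ^+ s * t k ^+ (d - s)) = f s.+1.
  by rewrite mulrA -exprS /f subSS.
have tkE (s : 'I_d) : t k * (t j ^+ s * t k ^+ (d - s)) = f s.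
  rewrite mulrA (commrX s (t_comm k j)) -mulrA -exprS /f.
  by rewrite subSn // ltnW.
rewrite !mulr_sumr (eq_bigr _ (fun s _ => tjE s)).
rewrite (eq_bigr _ (fun s _ => tkE s)).
(* The sums of f over 1, ..., d and 0, ..., d - 1 agree since f 0 = f d. *)
apply: (addrI (f 0%N)); rewrite -(big_ord_recl d f) big_ord_recr /= addrC.
congr (_ + _); rewrite /f.
by rewrite subSnn expr1 t_order expr0 subn0 exprS t_order mul1r mul1r mulr1.
Qed.

Lemma tX_e j k s : t j ^+ s * e j k = t k ^+ s * e j k.
Proof.
elim: s => // s IHs; rewrite exprSr -mulrA t_e mulrA.
by rewrite -(commrX s (t_comm k j)) -mulrA IHs mulrA -exprS.
Qed.

End Relations.

(** * The spanning set of each floor of the tower *)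

(** The argument applies to any tower of algebras generated by elements g_i, t_j
    that satisfy the relations and are compatible with the inclusions. [A m]
    stands for Y_{m+1}, so that g has m indices and t has m + 1, and [gl m],
    [tl m] are the last generators g_{m+1} of [A m.+1] and t_{m+1} of [A m]. *)
Section Tower.
Context {K : fieldType} {u : K} {d : nat} {A : nat -> algType K}.
Context {g : forall m, 'I_m -> A m} {t : forall m, 'I_m.+1 -> A m}.
Hypothesis sat : forall m, @yh_sat K u d m.+1 (A m) (@g m) (@t m).
Hypothesis gen_ind : forall m (P : A m -> Prop),
  P 1 -> (forall a b, P a -> P b -> P (a + b)) ->
  (forall c a, P a -> P (c *: a)) ->
  (forall a i, P a -> P (a * g i)) ->
  (forall a j, P a -> P (a * t j)) -> forall a, P a.
Context {incl : forall m, {lrmorphism A m -> A m.+1}}.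
Hypothesis incl_g : forall m (i : 'I_m) (i' : 'I_m.+1), i' = i :> nat ->
  incl m (g i) = g i'.
Hypothesis incl_t : forall m (j : 'I_m.+1) (j' : 'I_m.+2), j' = j :> nat ->
  incl m (t j) = t j'.

Local Notation gl m := (@g m.+1 ord_max).
Local Notation tl m := (@t m ord_max).

Let incl1 m : incl m 1 = 1. Proof. exact: rmorph1. Qed.
Let inclD m a b : incl m (a + b) = incl m a + incl m b.
Proof. exact: rmorphD. Qed.
Let inclM m a b : incl m (a * b) = incl m a * incl m b.
Proof. exact: rmorphM. Qed.
Let inclX m a s : incl m (a ^+ s) = incl m a ^+ s.
Proof. exact: rmorphXn. Qed.
Let inclZ m c a : incl m (c *: a) = c *: incl m a.
Proof. exact: linearZ. Qed.

Lemma last_or_lower m (i : 'I_m.+1) :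
  i = ord_max \/ exists i' : 'I_m, i = i' :> nat.
Proof.
case: (unliftP ord_max i) => [i' ->|->]; [right | by left].
by exists i'; rewrite lift_max.
Qed.

(** The linear span of all a t^s and a g b, with t and g the last generators;
    stability under scaling follows as the factor a can absorb scalars. *)
Inductive last_span m : A m.+1 -> Prop :=
| LastD a b : last_span a -> last_span b -> last_span (a + b)
| LastT a s : last_span (incl m a * tl m.+1 ^+ s)
| LastG a b : last_span (incl m a * gl m * incl m b).

Lemma last_spanZ m c (y : A m.+1) : last_span y -> last_span (c *: y).
Proof.
elim=> [a b _ Va _ Vb|a s|a b].
- by rewrite scalerDr; apply: LastD.
- by rewrite scalerAl -inclZ; apply: LastT.
- by rewrite 2!scalerAl -inclZ; apply: LastG.
Qed.

Lemma last_span_incl m a : last_span (incl m a).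
Proof. by rewrite -[incl m a]mulr1 -(expr0 (tl m.+1)); apply: LastT. Qed.

Lemma last_span_sum m (I : finType) (F : I -> A m.+1) :
  (forall i, last_span (F i)) -> last_span (\sum_i F i).
Proof.
move=> VF; elim/big_ind: _ => //; last exact: LastD.
by rewrite -(rmorph0 (incl m)); apply: last_span_incl.
Qed.

Lemma tl_comm_incl m a : tl m.+1 * incl m a = incl m a * tl m.+1.
Proof.
elim/gen_ind: a => [|a b Ha Hb|c a Ha|a i Ha|a j Ha].
- by rewrite incl1 mulr1 mul1r.
- by rewrite inclD mulrDr mulrDl Ha Hb.
- by rewrite inclZ -scalerAr -scalerAl Ha.
- rewrite inclM mulrA Ha -!mulrA; congr (_ * _).
  rewrite (incl_g (i' := widen_ord (leqnSn m) i)) //.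
  by rewrite (g_t (@sat m.+1)) //= gtn_eqF // ltnS // ltnW.
- rewrite inclM mulrA Ha -!mulrA; congr (_ * _).
  rewrite (incl_t (j' := widen_ord (leqnSn m.+1) j)) //.
  by rewrite (t_comm (@sat m.+1)).
Qed.

Lemma gl_comm_incl2 m a :
  gl m.+1 * incl m.+1 (incl m a) = incl m.+1 (incl m a) * gl m.+1.
Proof.
elim/gen_ind: a => [|a b Ha Hb|c a Ha|a i Ha|a j Ha].
- by rewrite !incl1 mulr1 mul1r.
- by rewrite !inclD mulrDr mulrDl Ha Hb.
- by rewrite !inclZ -scalerAr -scalerAl Ha.
- rewrite !inclM mulrA Ha -!mulrA; congr (_ * _).
  pose i1 := widen_ord (leqnSn m) i.
  rewrite (incl_g (i' := i1)) //.
  rewrite (incl_g (i' := widen_ord (leqnSn m.+1) i1)) //.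
  by rewrite (g_far (@sat m.+2)) //= !ltnS ltn_ord orbT.
- rewrite !inclM mulrA Ha -!mulrA; congr (_ * _).
  pose j1 := widen_ord (leqnSn m.+1) j.
  rewrite (incl_t (j' := j1)) //.
  rewrite (incl_t (j' := widen_ord (leqnSn m.+2) j1)) //.
  by rewrite (g_t (@sat m.+2)) //= ltn_eqF // ltnW // ltnS.
Qed.

Lemma tl_prev m : gl m * tl m.+1 = incl m (tl m) * gl m.
Proof.
rewrite (incl_t (j' := widen_ord (leqnSn m.+1) ord_max)) //.
exact: (g_tr (@sat m.+1)).
Qed.

Lemma tl_nextX m s : gl m * incl m (tl m) ^+ s = tl m.+1 ^+ s * gl m.
Proof.
rewrite (incl_t (j' := widen_ord (leqnSn m.+1) ord_max)) //.
exact: (g_tlX (@sat m.+1)).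
Qed.

Lemma gl_quad m :
  gl m ^+ 2 = 1 + (u - 1) *: yh_e d (incl m (tl m)) (tl m.+1)
    + (u - 1) *: (yh_e d (incl m (tl m)) (tl m.+1) * gl m).
Proof.
rewrite (incl_t (j' := widen_ord (leqnSn m.+1) ord_max)) //.
exact: (g_quad (@sat m.+1)).
Qed.

Lemma last_span_mul_incl m (y : A m.+1) b :
  last_span y -> last_span (y * incl m b).
Proof.
elim=> [a c _ Va _ Vc|a s|a c].
- by rewrite mulrDl; apply: LastD.
- rewrite -mulrA -(commrX s (esym (tl_comm_incl b))) mulrA -inclM.
  exact: LastT.
- by rewrite -mulrA -inclM; apply: LastG.
Qed.

Lemma last_span_mul_tl m (y : A m.+1) : last_span y -> last_span (y * tl m.+1).
Proof.
elim=> [a c _ Va _ Vc|a s|a c].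
- by rewrite mulrDl; apply: LastD.
- by rewrite -mulrA -exprSr; apply: LastT.
- rewrite -mulrA -tl_comm_incl mulrA -[_ * gl m * _]mulrA tl_prev mulrA.
  by rewrite -inclM; apply: LastG.
Qed.

Lemma last_span_t_gl m a s : last_span (incl m a * tl m.+1 ^+ s * gl m).
Proof. by rewrite -mulrA -tl_nextX mulrA -inclX; apply: LastG. Qed.

(** The quadratic relation replaces g^2 by 1, e and e g, and e only shifts
    powers of the last t at the cost of elements of the previous floor. *)
Lemma last_span_t_gl2 m a s :
  last_span (incl m a * tl m.+1 ^+ s * gl m ^+ 2).
Proof.
have teE : incl m a * tl m.+1 ^+ s * yh_e d (incl m (tl m)) (tl m.+1) =
    d%:R^-1 *: \sum_(r < d) incl m (a * tl m ^+ r) * tl m.+1 ^+ (s + (d - r)).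
  rewrite /yh_e -scalerAr mulr_sumr; congr (_ *: _); apply: eq_bigr => r _.
  rewrite -inclX -mulrA [_ ^+ s * _]mulrA -(commrX s (esym (tl_comm_incl _))).
  by rewrite -mulrA -exprD mulrA -inclM.
rewrite gl_quad !mulrDr mulr1 -!(scalerAr (u - 1)) mulrA teE.
apply: LastD; first (apply: LastD; first exact: LastT).
- by do 2!apply: last_spanZ; apply: last_span_sum => r; apply: LastT.
- apply: last_spanZ; rewrite -scalerAl; apply: last_spanZ.
  by rewrite mulr_suml; apply: last_span_sum => r; apply: last_span_t_gl.
Qed.

(** The span contains 1 and is stable under right multiplication by all
    generators; the only case that needs to look into the previous floor is a
    second factor g. *)
Lemma last_span_gl_gl m :
    (forall a b, last_span (incl m a * gl m * incl m b * gl m)) ->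
  forall y : A m.+1, last_span y.
Proof.
move=> Vgg; elim/gen_ind=> [|a b Va Vb|c a Va|a i Va|a j Va].
- by rewrite -incl1; apply: last_span_incl.
- exact: LastD.
- exact: last_spanZ.
- have [-> {i}|[i' ii']] := last_or_lower i; last first.
    by rewrite -(incl_g ii'); apply: last_span_mul_incl.
  elim: Va => [b c _ Vb _ Vc|b s|b c] //.
  + by rewrite mulrDl; apply: LastD.
  + exact: last_span_t_gl.
- have [-> {j}|[j' jj']] := last_or_lower j; last first.
    by rewrite -(incl_t jj'); apply: last_span_mul_incl.
  exact: last_span_mul_tl.
Qed.

(** In a g b g the element b of the previous floor is, by induction, a sum of
    products of elements commuting with g and either a power of t, which moves
    across g and leaves g^2, or one g', where the braid relation
    g g' g = g' g g' leaves a single g. *)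
Theorem last_spanT m (y : A m.+1) : last_span y.
Proof.
elim: m y => [|m IHm]; apply: last_span_gl_gl => a b.
  (* The first floor is generated by t alone; the exponent s is generalized
     because the induction appends factors t to b. *)
  pose P b := forall s,
    last_span (incl 0 a * gl 0 * incl 0 (b * tl 0 ^+ s) * gl 0).
  suff /(_ b 0%N): forall b, P b by rewrite expr0 mulr1.
  move=> {}b s; apply: (gen_ind (P := P)) b s
      => [s|b c Vb Vc s|c b Vb s|b []//|b j Vb s].
  - rewrite mul1r inclX -(mulrA (incl 0 a)) tl_nextX mulrA -mulrA.
    exact: last_span_t_gl2.
  - by rewrite mulrDl inclD mulrDr mulrDl; apply: LastD.
  - by rewrite -scalerAl inclZ -scalerAr -scalerAl; apply: last_spanZ.
  - have -> : j = ord_max by rewrite [LHS]ord1 [RHS]ord1.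
    by rewrite -(mulrA b) -exprS.
elim: {b}(IHm b) => [b c _ Vb _ Vc|b s|b c].
- by rewrite inclD mulrDr mulrDl; apply: LastD.
- rewrite inclM mulrA -(mulrA _ (gl _)) gl_comm_incl2 mulrA -inclM.
  rewrite -(mulrA _ (gl _)) inclX tl_nextX mulrA -mulrA.
  exact: last_span_t_gl2.
- rewrite !inclM !mulrA -(mulrA _ (gl _)) gl_comm_incl2 mulrA -inclM.
  rewrite -(mulrA _ _ (gl _)) -gl_comm_incl2 mulrA.
  rewrite -2!(mulrA (incl _ (a * _))).
  pose i1 : 'I_m.+2 := widen_ord (leqnSn m.+1) ord_max.
  rewrite (incl_g (i' := i1)) // (g_braid (@sat m.+2)) //.
  rewrite -(incl_g (i := ord_max) (i' := i1)) // !mulrA -inclM -mulrA -inclM.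
  exact: LastG.
Qed.

(** * The radical of the trace form *)

(** Since x_s = chi^s with chi^d = 1, the Markov rule for t holds with all
    exponents s. *)
Section Trace.
Context {tr : forall m, {scalar A m}} {z chi : K}.
Hypothesis tr_incl : forall m (a : A m), tr m.+1 (incl m a) = tr m a.
Hypothesis trC : forall m (a b : A m), tr m (a * b) = tr m (b * a).
Hypothesis tr_1 : forall m, tr m 1 = 1.
Hypothesis tr_g : forall m (a : A m), tr m.+1 (incl m a * gl m) = z * tr m a.
Hypothesis tr_t : forall m (a : A m) s,
  tr m.+1 (incl m a * tl m.+1 ^+ s) = chi ^+ s * tr m a.

Let trD m a b : tr m (a + b) = tr m a + tr m b.
Proof. exact: linearD. Qed.
Let trB m a b : tr m (a - b) = tr m a - tr m b.
Proof. exact: linearB. Qed.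
Let trZ m c a : tr m (c *: a) = c * tr m a.
Proof. exact: linearZ. Qed.

Definition tr_radical m (c : A m) := forall a, tr m (a * c) = 0.

Lemma tr_radical_ideal m : two_sided_ideal (@tr_radical m).
Proof.
split=> [c|a b Ja Jb c|a b Jb c|a b Ja c].
- by rewrite mulr0 -(scale0r 1) trZ mul0r.
- by rewrite mulrDr trD Ja Jb addr0.
- by rewrite mulrA.
- by rewrite mulrA trC mulrA.
Qed.

(** By cyclicity, c multiplies the factors of the lower floor: tr(a t^s c) and
    tr(a g b c) become multiples of tr(ca) and tr(bca). *)
Lemma tr_radical_incl m (c : A m) : tr_radical c -> tr_radical (incl m c).
Proof.
move=> Jc y; elim: {y}(last_spanT y) => [a b _ Ja _ Jb|a s|a b].
- by rewrite mulrDl trD Ja Jb addr0.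
- by rewrite trC mulrA -inclM tr_t trC Jc mulr0.
- rewrite -mulrA -inclM trC mulrA -inclM tr_g.
  by rewrite trC mulrA Jc mulr0.
Qed.

(** The Markov rule for t starts with t_2^s and says nothing on t_1^s. With
    g t_1 = t_2 g, tr(t_1^s g^2) = tr(g t_1^s g) = tr(t_2^s g^2), and the terms
    of g^2 that contain e cancel because t_1^s e = t_2^s e. *)
Lemma tr_t0X s : tr 0 (t ord0 ^+ s) = chi ^+ s.
Proof.
rewrite -tr_incl inclX.
have -> : t (ord0 : 'I_1) = tl 0 by congr (t _); rewrite [RHS]ord1.
set t0 := incl 0 (tl 0); set e := yh_e d t0 (tl 1).
have eE : t0 ^+ s * e = tl 1 ^+ s * e.
  rewrite /e /t0 (incl_t (j' := widen_ord (leqnSn 1) ord_max)) //.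
  exact: (tX_e (@sat 1)).
have : tr 1 (t0 ^+ s * gl 0 ^+ 2) = tr 1 (tl 1 ^+ s * gl 0 ^+ 2).
  by rewrite expr2 mulrA trC !mulrA tl_nextX.
rewrite gl_quad -/t0 -/e !mulrDr -!(scalerAr (u - 1)) !mulrA eE !trD !mulr1.
by move/addIr/addIr => ->; rewrite -[_ ^+ s]mul1r -incl1 tr_t tr_1 mulr1.
Qed.

Lemma tr_mul_t0 (a : A 0) : tr 0 (a * t ord0) = chi * tr 0 a.
Proof.
suff H s : tr 0 (a * t ord0 ^+ s) = chi ^+ s * tr 0 a.
  by have := H 1%N; rewrite !expr1.
pose P a := forall s, tr 0 (a * t ord0 ^+ s) = chi ^+ s * tr 0 a.
apply: (gen_ind (P := P)) a s => [s|a b Pa Pb s|c a Pa s|a []//|a j Pa s].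
- by rewrite mul1r tr_t0X tr_1 mulr1.
- by rewrite mulrDl !trD Pa Pb mulrDr.
- by rewrite -scalerAl !trZ Pa mulrCA.
- rewrite [j]ord1 -mulrA -exprS Pa -[X in a * X]expr1 Pa.
  by rewrite mulrA -exprD addn1.
Qed.

Lemma tr_mul_tP m (j : 'I_m.+1) :
  (forall a, tr m (a * t j) = chi * tr m a) <-> tr_radical (t j - chi%:A).
Proof.
split=> H a; last apply/eqP; last rewrite -subr_eq0; last apply/eqP.
  by rewrite mulrBr trB H -scalerAr mulr1 trZ subrr.
by rewrite -trZ -trB -[RHS](H a) mulrBr -scalerAr mulr1.
Qed.

(** Write k = j + 1. Cyclicity and g t_j = t_k g give
    tr(a (t_k - chi) g^2) = tr(g a g (t_j - chi)) = 0. The terms with e in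
    g^2 = 1 + (u - 1) e (1 + g) contribute 0 as well, since
    (t_k - chi) e = (t_j - chi) e; what remains is tr(a (t_k - chi)). *)
Lemma tr_mul_t_next m (i : 'I_m) (j k : 'I_m.+1) :
    j = i :> nat -> k = i.+1 :> nat ->
  (forall a, tr m (a * t j) = chi * tr m a) ->
  forall a, tr m (a * t k) = chi * tr m a.
Proof.
move=> ji ki trj a.
have g2E := g_quad (@sat m) ji ki; set e := yh_e d _ _ in g2E.
have eE : t j * e = t k * e := t_e (@sat m) j k.
have trje b : tr m (a * t k * e * b) = chi * tr m (a * e * b).
  by rewrite -(mulrA a) -eE !mulrA -mulrA trC mulrA trj trC mulrA.
have : tr m (a * t k * g i ^+ 2) = chi * tr m (a * g i ^+ 2).
  rewrite expr2 !mulrA -(mulrA a) -(g_tl (@sat m) ji ki) mulrA.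
  by rewrite trC !mulrA trj -mulrA trC.
rewrite g2E !mulrDr -!(scalerAr (u - 1)) !mulrA !mulr1 !trD !trZ !mulrDr trje.
have := trje 1; rewrite !mulr1 => ->.
by rewrite !(mulrCA _ chi) => /addIr/addIr.
Qed.

(** * Reduction to the Iwahori--Hecke relation *)

Lemma tr_mul_t m (j : 'I_m.+1) a : tr m (a * t j) = chi * tr m a.
Proof.
have trt0 n b : tr n (b * t ord0) = chi * tr n b.
  elim: n b => [|n /tr_mul_tP/tr_radical_incl Jt]; first exact: tr_mul_t0.
  apply/tr_mul_tP; move: Jt.
  by rewrite rmorphB /= (incl_t (j' := ord0)) // inclZ incl1.
case: j => j jm; elim: j jm a => [|j IHj] jm a.
  by rewrite -trt0; congr (tr m (a * t _)); apply: val_inj.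
exact: (@tr_mul_t_next m (Ordinal (jm : (j < m)%N)) (Ordinal (ltnW jm))).
Qed.

Lemma tr_mul_tX m (j : 'I_m.+1) a s : tr m (a * t j ^+ s) = chi ^+ s * tr m a.
Proof.
elim: s => [|s IHs]; first by rewrite !expr0 mulr1 mul1r.
by rewrite exprSr mulrA tr_mul_t IHs mulrA -exprS.
Qed.

Hypotheses (d_neq0 : d%:R != 0 :> K) (u_neq0 : u != 0) (chi_d : chi ^+ d = 1).

Lemma tr_mul_e m (j k : 'I_m.+1) a : tr m (a * yh_e d (t j) (t k)) = tr m a.
Proof.
rewrite /yh_e -scalerAr trZ mulr_sumr linear_sum /=.
under eq_bigr => s _.
  rewrite mulrA !tr_mul_tX mulrA -exprD subnK; last exact: ltnW.
  rewrite chi_d mul1r; over.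
by rewrite sumr_const card_ord -(mulr_natl (tr m a)) mulrA mulVf // mul1r.
Qed.

Lemma tr_mul_g2 m (i : 'I_m) a :
  tr m (a * g i ^+ 2) = u * tr m a + (u - 1) * tr m (a * g i).
Proof.
pose j := widen_ord (leqnSn m) i.
rewrite (g_quad (@sat m) (j := j) (k := lift ord0 i)) //.
set e := yh_e _ _ _; rewrite !mulrDr mulr1 -!(scalerAr (u - 1)) !trD !trZ.
have -> : tr m (a * (e * g i)) = tr m (a * g i).
  by rewrite mulrA trC mulrA tr_mul_e trC.
by rewrite tr_mul_e; ring.
Qed.

(** Modulo the radical, g^2 = u + (u - 1) g with u <> 0, so g is a unit. *)
Lemma tr_radical_cancel m (i : 'I_m) c : tr_radical (c * g i) -> tr_radical c.
Proof.
move=> Jcg a; have [_ _ _ JM] := tr_radical_ideal m.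
have := JM _ (g i) Jcg a; rewrite -mulrA -expr2 mulrA tr_mul_g2.
rewrite -(mulrA a) Jcg mulr0 addr0 => /eqP.
by rewrite mulf_eq0 (negPf u_neq0) => /eqP.
Qed.

(** * The Temperley--Lieb elements lie in the radical *)

Definition gg m (i j : 'I_m) : A m :=
  1 + g i + g j + g i * g j + g j * g i + g i * g j * g i.

Lemma gg_factor m (i j : 'I_m) :
  gg i j = (1 + g i) * (1 + g j + g j * g i).
Proof.
rewrite mulrDl mul1r !mulrDr mulr1 !addrA !mulrA.
by rewrite [LHS](+%R.[ACl 1*3*5*2*4*6]).
Qed.

Lemma gg_sym m (i j : 'I_m) : j = i.+1 :> nat -> gg j i = gg i j.
Proof.
move=> ji; rewrite /gg (g_braid (@sat m) ji).
by rewrite [LHS](+%R.[ACl 1*3*2*5*4*6]).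
Qed.

Lemma incl_gg m (i j : 'I_m) (i' j' : 'I_m.+1) :
  i' = i :> nat -> j' = j :> nat -> incl m (gg i j) = gg i' j'.
Proof.
by move=> ii' jj'; rewrite /gg !inclD !inclM incl1 (incl_g ii') (incl_g jj').
Qed.

(** The left factor 1 + g_i of g_{i,j} is an eigenvector of g_i for u, by the
    Hecke relation. *)
Lemma tr_mul_gg m (i j : 'I_m) a :
  tr m (a * g i * gg i j) = u * tr m (a * gg i j).
Proof.
rewrite gg_factor; set c := _ + g j * g i.
rewrite !mulrA trC mulrA [in RHS]trC !mulrA.
rewrite -(mulrA (c * a)) !mulrDr !mulr1 -expr2 !trD tr_mul_g2.
by ring.
Qed.

(** The braid w = g_i g_j g_k on consecutive generators shifts them:
    w g_i = g_j w and w g_j = g_k w. *)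
Lemma gg_conj m (i j k : 'I_m) : j = i.+1 :> nat -> k = j.+1 :> nat ->
  g i * g j * g k * gg i j = gg j k * (g i * g j * g k).
Proof.
move=> ji kj; set w := _ * g k.
have wi : w * g i = g j * w.
  rewrite /w -mulrA -(g_far (@sat m) (i := i)); last by rewrite kj ji ltnSn.
  by rewrite !mulrA (g_braid (@sat m) ji).
have wj : w * g j = g k * w.
  rewrite /w -!mulrA (mulrA (g j)) -(g_braid (@sat m) kj) !mulrA.
  by rewrite (g_far (@sat m) (i := i)) // kj ji ltnSn.
have wM x y x' y' :
    w * x = x' * w -> w * y = y' * w -> w * (x * y) = x' * y' * w.
  by move=> wx wy; rewrite mulrA wx -mulrA wy mulrA.
rewrite /gg !mulrDr !mulrDl mulr1 mul1r wi wj.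
have wij := wM _ _ _ _ wi wj; have wji := wM _ _ _ _ wj wi.
by rewrite wij wji (wM _ _ _ _ wij wi).
Qed.

Lemma tr_radical_gg_next m (i j k : 'I_m) :
    j = i.+1 :> nat -> k = j.+1 :> nat ->
  tr_radical (gg i j) -> tr_radical (gg j k).
Proof.
move=> ji kj Jgg; have [_ _ JM _] := tr_radical_ideal m.
have := JM (g i * g j * g k) _ Jgg; rewrite gg_conj // !mulrA.
by do 3!move/tr_radical_cancel.
Qed.

Hypothesis z_root : (z + 1) * ((u + 1) * z + 1) = 0.

(** Here tr(g_1) = tr(g_2) = z, tr(g_1 g_2) = tr(g_2 g_1) = z^2 and
    tr(g_1 g_2 g_1) = z tr(g_1^2) = z (u + (u - 1) z), and the total factors as
    in the hypothesis on z. *)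
Lemma tr_gg01 (i j : 'I_2) : j = i.+1 :> nat -> tr 2 (gg i j) = 0.
Proof.
move=> ji.
have i0 : i = 0%N :> nat by case: i j ji => [[|[]]] // ? [[|[|]]].
have jE : j = ord_max by apply: val_inj; rewrite /= ji i0.
have iE : g i = incl 1 (gl 0) by rewrite (incl_g (i' := i)).
have trg0 : tr 1 (gl 0) = z.
  by rewrite -[gl 0]mul1r -incl1 tr_g tr_1 mulr1.
have trg1 : tr 2 (gl 1) = z.
  by rewrite -[gl 1]mul1r -incl1 tr_g tr_1 mulr1.
rewrite /gg jE iE !trD tr_1 tr_incl trg0 trg1 (trC (gl 1)) tr_g trg0.
rewrite (trC (_ * gl 1)) mulrA -inclM tr_g -(expr2 (gl 0)).
rewrite -[gl 0 ^+ 2]mul1r tr_mul_g2 tr_1 mul1r trg0 -[RHS]z_root; ring.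
Qed.

Lemma tr_radical_gg01 (i j : 'I_2) : j = i.+1 :> nat -> tr_radical (gg i j).
Proof.
move=> ji.
apply: (gen_ind (P := fun a => tr 2 (a * gg i j) = 0))
    => [|a b Pa Pb|c a Pa|a k Pa|a k Pa].
- by rewrite mul1r tr_gg01.
- by rewrite mulrDl trD Pa Pb addr0.
- by rewrite -scalerAl trZ Pa mulr0.
- have [->|->] : k = i \/ k = j.
    case: i j k ji {Pa} => [[|[]]] // ? [[|[|]]] // ? [[|[|]]] // ? _;
      [left | right]; exact: val_inj.
  + by rewrite tr_mul_gg Pa mulr0.
  + by rewrite -gg_sym // tr_mul_gg gg_sym // Pa mulr0.
- by rewrite trC mulrA tr_mul_t trC Pa mulr0.
Qed.

(** The pair (0, 1) comes from the floor with two generators g by inclusion, and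
    the others are reached from it by conjugation. *)
Theorem tr_radical_gg m (i j : 'I_m) : j = i.+1 :> nat -> tr_radical (gg i j).
Proof.
case: i => i im; elim: i im j => [|i IHi] im j /= ji; last first.
  apply: (@tr_radical_gg_next m (Ordinal (ltnW im)) (Ordinal im) j) => //.
  exact: IHi.
elim: m im j ji => // m IHm im j ji.
have jm := ltn_ord j; rewrite ji ltnS in jm.
case: m => [|[|m]] // in IHm im j ji jm *.
  exact: tr_radical_gg01.
pose i0 : 'I_m.+2 := Ordinal (isT : (0 < m.+2)%N).
pose i1 : 'I_m.+2 := Ordinal (isT : (1 < m.+2)%N).
rewrite -(@incl_gg _ i0 i1) //.
by apply: tr_radical_incl; apply: IHm.
Qed.

Theorem tr_gg_ideal m (a : A m) :
  ideal_gen (fun b => exists i j : 'I_m,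
    (j == i.+1 :> nat) || (i == j.+1 :> nat) /\ b = gg i j) a -> tr m a = 0.
Proof.
move=> Ia; rewrite -[a]mul1r.
apply: (Ia _ (tr_radical_ideal m)) => _ [i [j [/orP[]/eqP ij ->]]].
  exact: tr_radical_gg.
by rewrite gg_sym //; apply: tr_radical_gg.
Qed.

End Trace.
End Tower.

(** * The Yokonuma--Hecke tower *)

(** Over a general field z enters through a quadratic equation, whose left-hand
    side is the trace of g_{1,2}. *)
Theorem markov_trace_passes_to_ytl (K : fieldType) (u : K) (d : nat) (z chi : K)
    (x : nat -> K) (tr : forall m, {scalar yokonuma_hecke u d m}) n :
    is_markov_trace z x tr ->
    d%:R != 0 :> K -> u != 0 -> chi ^+ d = 1 ->
    (forall s, (1 <= s <= d - 1)%N -> x s = chi ^+ s) ->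
    (z + 1) * ((u + 1) * z + 1) = 0 ->
  passes_to_ytl (tr n.+1).
Proof.
move=> [tr_incl trC tr_1 tr_g tr_t] d_neq0 u_neq0 chi_d xE z_root.
pose A m : algType K := yokonuma_hecke u d m.+1.
pose g m : 'I_m -> A m := @yh_g K u d m.+1.
pose t m : 'I_m.+1 -> A m := @yh_t K u d m.+1.
pose incl m : {lrmorphism A m -> A m.+1} := @yh_incl K u d m.+1.
pose trA m : {scalar A m} := tr m.+1.
have incl_g m (i : 'I_m) (i' : 'I_m.+1) :
    i' = i :> nat -> incl m (g m i) = g m.+1 i'.
  move=> ii'; apply: (etrans (@yh_incl_g K u d m.+1 i)).
  by congr (@yh_g K u d m.+2 _); apply: val_inj.
have incl_t m (j : 'I_m.+1) (j' : 'I_m.+2) :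
    j' = j :> nat -> incl m (t m j) = t m.+1 j'.
  move=> jj'; apply: (etrans (@yh_incl_t K u d m.+1 j)).
  by congr (@yh_t K u d m.+2 _); apply: val_inj.
have trA_t m (a : A m) s :
    trA m.+1 (incl m a * t m.+1 ord_max ^+ s) = chi ^+ s * trA m a.
  have d_gt0 : (0 < d)%N by rewrite lt0n; apply: contra_neq d_neq0 => ->.
  have tE : t m.+1 ord_max ^+ s = t m.+1 ord_max ^+ (s %% d).
    rewrite [in LHS](divn_eq s d) exprD mulnC exprM.
    by rewrite (t_order (@yh_gen_sat K u d m.+2)) expr1n mul1r.
  have chiE : chi ^+ s = chi ^+ (s %% d).
    by rewrite [in LHS](divn_eq s d) exprD mulnC exprM chi_d expr1n mul1r.
  rewrite tE chiE; have := ltn_pmod s d_gt0; case: (s %% d)%N => [_|r rd].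
    by rewrite !expr0 mulr1 mul1r; apply: tr_incl.
  have rd1 : (1 <= r.+1 <= d - 1)%N by rewrite ltn_subRL add1n.
  by rewrite -xE //; apply: tr_t.
by apply: (@tr_gg_ideal K u d A g t (fun m => @yh_gen_sat K u d m.+1)
  (fun m => @yh_ind K u d m.+1) incl incl_g incl_t trA z chi
  tr_incl trC tr_1 tr_g trA_t).
Qed.

Theorem theorem4 (R : realType) (d n : nat) (hd : (1 <= d)%N) (hn : (3 <= n)%N)
    (z : Cu R) (x : nat -> R[i])
    (tr : forall m : nat, {scalar yokonuma_hecke (indet R) d m})
    (htr : is_markov_trace z (fun s => Cu_const (x s)) tr)
    (hx : forall i : nat, (1 <= i <= d - 1)%N ->
      x i ^+ d = 1 /\ x i = x 1%N ^+ i)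
    (hz : z = - (indet R + 1)^-1 \/ z = -1) :
  passes_to_ytl (tr n).
Proof.
case: n hn => // n _.
have constX (c : R[i]) s : Cu_const c ^+ s = Cu_const (c ^+ s).
  by rewrite /Cu_const polyC_exp rmorphXn.
(* For d = 1 the value of x at 1 is unconstrained, while t_1 = 1. *)
pose chi : R[i] := if (1 < d)%N then x 1%N else 1.
have u1 : indet R + 1 != 0.
  rewrite /indet -[1](rmorph1 (@tofrac {poly R[i]})) -rmorphD /= tofrac_eq0.
  by rewrite -[1 in X in X != 0]opprK -polyC1 -polyCN polyXsubC_eq0.
apply: (@markov_trace_passes_to_ytl _ _ _ z (Cu_const chi) _ _ _ htr).
- rewrite -(rmorph_nat (@tofrac {poly R[i]})) /= tofrac_eq0.
  rewrite -polyC_natr polyC_eq0.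
  by rewrite Num.Theory.pnatr_eq0 -lt0n.
- by rewrite /indet tofrac_eq0 polyX_eq0.
- rewrite constX; suff -> : chi ^+ d = 1 by rewrite /Cu_const polyC1 rmorph1.
  rewrite /chi; case: ltnP => d1; last by rewrite expr1n.
  by apply: (proj1 (hx 1%N _)); rewrite subn_gt0.
- move=> s sd; rewrite constX /chi.
  have -> : (1 < d)%N.
    by case/andP: sd => s1 sd; rewrite -subn_gt0 (leq_trans s1).
  by rewrite -(proj2 (hx s sd)).
- case: hz => ->; last by rewrite addNr mul0r.
  by rewrite mulrN divff // addNr mulr0.
Qed.
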